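(* Let $\mathcal{R}(t)$ and $\mathcal{A}(t)$ be, respectively, repelling and attracting Lagrangian coherent structures (LCSs) of the dynamical system $\dot x=u(x,t)$ over the time interval $[a,b]$. Then the following hold: (i) A repelling LCS, $\mathcal{R}(t)$, is a forward strain-surface, i.e., $\mathcal{R}(a)$ is everywhere orthogonal to the eigenvector field $\xi_n^f$. Furthermore, $\mathcal{R}(t)$ is also a backward stretch-surface, i.e., $\mathcal{R}(b)$ is everywhere orthogonal to the eigenvector field $\xi_1^b$. (ii) An attracting LCS, $\mathcal{A}(t)$, is a forward stretch-surface, i.e., $\mathcal{A}(a)$ is everywhere orthogonal to the eigenvector field $\xi_1^f$. Furthermore, $\mathcal{A}(t)$ is also a backward strain-surface, i.e., $\mathcal{A}(b)$ is everywhere orthogonal to the eigenvector field $\xi_n^b$.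
   Context: Setting: $U\subset\mathbb{R}^n$, $I=[a,b]$, and $u:U\times I\to\mathbb{R}^n$ is a sufficiently smooth velocity field. For $t_0,t\in I$ the flow map $F_{t_0}^t:U\to U$ of $\dot x=u(x,t)$ is the unique one-to-one map that takes an initial condition $x_0$ (at time $t_0$) to its time-$t$ position $x(t;t_0,x_0)$; in particular it is invertible, and $F_b^a(F_a^b(x_a))=x_a$ for all $x_a\in U$. The forward and backward Cauchy--Green strain tensors over $I$ are $C^f=(\nabla F_a^b)^\top\nabla F_a^b$ and $C^b=(\nabla F_b^a)^\top\nabla F_b^a$. At each point these are symmetric positive definite $n\times n$ matrices. Their eigenvalues are $0<\lambda_1^f\le\lambda_2^f\le\dots\le\lambda_n^f$ and $0<\lambda_1^b\le\lambda_2^b\le\dots\le\lambda_n^b$, with corresponding orthonormal eigenvectors $\xi_1^f,\dots,\xi_n^f$ and $\xi_1^b,\dots,\xi_n^b$. Let $\mathcal{M}(t)$ be an $(n-1)$-dimensional smooth material surface in $U$, evolving under the flow map over $[a,b]$ as $\mathcal{M}(t)=F_a^t(\mathcal{M}(a))$, with tangent space $T_x\mathcal{M}$ at $x\in\mathcal{M}$. It is called a forward strain-surface if $T_{x_a}\mathcal{M}(a)\perp\xi_n^f(x_a)$ for all $x_a\in\mathcal{M}(a)$; a backward strain-surface if $T_{x_b}\mathcal{M}(b)\perp\xi_n^b(x_b)$ for all $x_b\in\mathcal{M}(b)$; a forward stretch-surface if $T_{x_a}\mathcal{M}(a)\perp\xi_1^f(x_a)$ for all $x_a\in\mathcal{M}(a)$;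 a backward stretch-surface if $T_{x_b}\mathcal{M}(b)\perp\xi_1^b(x_b)$ for all $x_b\in\mathcal{M}(b)$. A repelling LCS over $[a,b]$ is a codimension-one material surface that is pointwise more repelling over $[a,b]$ than any nearby material surface; an attracting LCS over $[a,b]$ is a codimension-one material surface that is pointwise more attracting over $[a,b]$ than any nearby material surface. It is taken as known from the earlier variational theory of hyperbolic LCSs that a repelling LCS satisfies $T_{x_a}\mathcal{R}(a)\perp\xi_n^f(x_a)$ for every $x_a\in\mathcal{R}(a)$, and an attracting LCS satisfies $T_{x_b}\mathcal{A}(b)\perp\xi_n^b(x_b)$ for every $x_b\in\mathcal{A}(b)$. *)

(* Defs.v *)
(* Points and vectors of R^(n+1) are row vectors. *)
From HB Require Import structures.
From mathcomp Require Import all_boot all_order all_algebra.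
From mathcomp Require Import all_classical all_reals all_analysis.
Set Implicit Arguments.
Unset Strict Implicit.
Unset Printing Implicit Defensive.
Import Order.TTheory GRing.Theory Num.Theory.
Import numFieldNormedType.Exports.
Local Open Scope classical_set_scope.
Local Open Scope ring_scope.

(* Intended for A open. *)
Fixpoint Ck_on (R : realType) (V W : normedModType R) (k : nat) (A : set V)
    (f : V -> W) : Prop :=
  match k with
  | 0%N => forall x, A x -> {for x, continuous f}
  | k'.+1 => (forall x, A x -> differentiable f x) /\
             (forall v, Ck_on k' A (fun x => 'D_v f x))
  end.

(* Regularity classes: Some k stands for C^k and None for C^oo. *)
Definition class_on (R : realType) (V W : normedModType R) (r : option nat)
    (A : set V) (f : V -> W) : Prop :=
  match r with
  | Some k => Ck_on k A f
  | None => forall k, Ck_on k A f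
  end.

Section Euclidean.
Context {R : realType} {n : nat}.
Implicit Types x v w : 'rV[R]_n.+1.

Definition dot v w : R := \sum_i v 0 i * w 0 i.

(* 'J acts on row vectors on the right, hence the transpose:
   nabla f x *m v^T = ('d f x v)^T. *)
Definition nabla (f : 'rV[R]_n.+1 -> 'rV[R]_n.+1) x : 'M[R]_n.+1 := ('J f x)^T.

Definition cauchy_green (f : 'rV[R]_n.+1 -> 'rV[R]_n.+1) x : 'M[R]_n.+1 :=
  (nabla f x)^T *m nabla f x.

(* Eigenvalues in nondecreasing order, repeated with multiplicity.
   [eigenspace] is about row vectors, which is harmless as C is symmetric. *)
Definition ordered_eigenframe (C : 'M[R]_n.+1) (lam : 'I_n.+1 -> R)
    (xi : 'I_n.+1 -> 'rV[R]_n.+1) : Prop :=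
  [/\ (forall i j : 'I_n.+1, (i <= j)%N -> lam i <= lam j),
      (forall i j, dot (xi i) (xi j) = (i == j)%:R) &
      (forall i, (xi i <= eigenspace C (lam i))%MS)].

(* Embedded hypersurfaces, described by slice charts phi (with inverse psi). *)
Definition hypersurface (r : option nat) (S : set 'rV[R]_n.+1) : Prop :=
  forall x, S x ->
  exists (V W : set 'rV[R]_n.+1) (phi psi : 'rV[R]_n.+1 -> 'rV[R]_n.+1),
  [/\ open V /\ open W,
      V x,
      class_on r V phi /\ class_on r W psi,
      (forall y, V y -> W (phi y) /\ psi (phi y) = y) /\
      (forall z, W z -> V (psi z) /\ phi (psi z) = z) &
      forall y, V y -> (S y <-> phi y 0 ord0 = 0)].

Definition tangent (S : set 'rV[R]_n.+1) x : set 'rV[R]_n.+1 :=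
  [set v | exists g : R -> 'rV[R]_n.+1,
    [/\ g 0 = x, (\forall s \near (0 : R), S (g s)) &
        is_derive (0 : R) (1 : R) g v]].

Definition tangent_orthogonal (S : set 'rV[R]_n.+1) x w : Prop :=
  forall v, tangent S x v -> dot v w = 0.

Definition unit_normal (S : set 'rV[R]_n.+1) x w : Prop :=
  dot w w = 1 /\ tangent_orthogonal S x w.

(* One-sided derivatives at the endpoints of [a, b]. *)
Definition trajectory (U : set 'rV[R]_n.+1) (a b : R)
    (u : 'rV[R]_n.+1 -> R -> 'rV[R]_n.+1) (g : R -> 'rV[R]_n.+1) : Prop :=
  forall t, t \in `[a, b] -> U (g t) /\
    h^-1 *: (g (t + h) - g t) @[h --> within [set h | t + h \in `[a, b]] 0^']
      --> u (g t) t.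

(* F t0 t is the flow map from time t0 to time t, defined through the
   existence and uniqueness of trajectories on [a, b].  The regularity of the
   flow maps is part of what "u is sufficiently smooth" provides. *)
Record smooth_flow (r : option nat) (U : set 'rV[R]_n.+1) (a b : R)
    (u : 'rV[R]_n.+1 -> R -> 'rV[R]_n.+1)
    (F : R -> R -> 'rV[R]_n.+1 -> 'rV[R]_n.+1) : Prop := SmoothFlow {
  velocity_continuous :
    {within U `*` [set` `[a, b]], continuous (fun p => u p.1 p.2)} ;
  velocity_class :
    forall t, t \in `[a, b] -> class_on r U (fun x => u x t) ;
  flow_trajectory :
    forall t0 x0, t0 \in `[a, b] -> U x0 -> trajectory U a b u (fun t => F t0 t x0) ;
  flow_initial :
    forall t0 x0, t0 \in `[a, b] -> U x0 -> F t0 t0 x0 = x0 ;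
  flow_unique :
    forall t0 (g : R -> 'rV[R]_n.+1), t0 \in `[a, b] -> trajectory U a b u g ->
    forall t, t \in `[a, b] -> g t = F t0 t (g t0) ;
  flow_class :
    forall t0 t, t0 \in `[a, b] -> t \in `[a, b] -> class_on r U (F t0 t)
}.

Definition material_surface (r : option nat) (U : set 'rV[R]_n.+1) (a b : R)
    (F : R -> R -> 'rV[R]_n.+1 -> 'rV[R]_n.+1)
    (M : R -> set 'rV[R]_n.+1) : Prop :=
  [/\ M a `<=` U, hypersurface r (M a) &
      forall t, t \in `[a, b] -> M t = F a t @` M a].

(* Growth factor of the distance from the evolving surface: if n0 and n1 are
   unit normals of the surface at x and of its image at f x, this is
   |<n1, nabla f(x) n0>|; the absolute value discards the orientation. *)
Definition normal_repulsion (f : 'rV[R]_n.+1 -> 'rV[R]_n.+1) x n0 n1 : R :=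
  `| dot n1 (n0 *m (nabla f x)^T) |.

(* The normal repulsion of M from time t0 to time t1 is, at each point x of
   M t0, strictly larger than that of any other material surface N which is
   C^1-close to M near x: N is met on the normal line to M t0 at x, at signed
   distance s from x, with unit normal m0.  Strictness is required as soon as
   the point of N or its tangent space differs from that of M (for small eps,
   m0 = - n0 is excluded). *)
Definition pointwise_most_repelling (r : option nat) (U : set 'rV[R]_n.+1)
    (a b : R) (F : R -> R -> 'rV[R]_n.+1 -> 'rV[R]_n.+1) (t0 t1 : R)
    (M : R -> set 'rV[R]_n.+1) : Prop :=
  forall x n0 n1, M t0 x ->
  unit_normal (M t0) x n0 -> unit_normal (M t1) (F t0 t1 x) n1 ->
  exists2 eps : R, 0 < eps &
  forall (N : R -> set 'rV[R]_n.+1) (s : R) m0 m1,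
  material_surface r U a b F N ->
  let y := x + s *: n0 in
  N t0 y ->
  unit_normal (N t0) y m0 -> unit_normal (N t1) (F t0 t1 y) m1 ->
  `|s| < eps -> `|m0 - n0| < eps -> (s, m0) != (0, n0) ->
  normal_repulsion (F t0 t1) y m0 m1 < normal_repulsion (F t0 t1) x n0 n1.

Definition repelling_LCS (r : option nat) (U : set 'rV[R]_n.+1) (a b : R)
    (F : R -> R -> 'rV[R]_n.+1 -> 'rV[R]_n.+1)
    (M : R -> set 'rV[R]_n.+1) : Prop :=
  material_surface r U a b F M /\ pointwise_most_repelling r U a b F a b M.

(* Attraction over [a, b] is repulsion in backward time: the normal repulsion
   from b to a along M is the inverse of the one from a to b. *)
Definition attracting_LCS (r : option nat) (U : set 'rV[R]_n.+1) (a b : R)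
    (F : R -> R -> 'rV[R]_n.+1 -> 'rV[R]_n.+1)
    (M : R -> set 'rV[R]_n.+1) : Prop :=
  material_surface r U a b F M /\ pointwise_most_repelling r U a b F b a M.

(* In the four definitions below xi is the eigenvector field of the forward
   tensor cauchy_green (F a b), resp. of the backward one cauchy_green (F b a);
   xi_1 has index ord0 and the last eigenvector has index ord_max. *)
Definition forward_strain_surface (r : option nat) (U : set 'rV[R]_n.+1)
    (a b : R) (F : R -> R -> 'rV[R]_n.+1 -> 'rV[R]_n.+1)
    (xi : 'rV[R]_n.+1 -> 'I_n.+1 -> 'rV[R]_n.+1)
    (M : R -> set 'rV[R]_n.+1) : Prop :=
  material_surface r U a b F M /\
  forall x, M a x -> tangent_orthogonal (M a) x (xi x ord_max).

Definition backward_strain_surface (r : option nat) (U : set 'rV[R]_n.+1)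
    (a b : R) (F : R -> R -> 'rV[R]_n.+1 -> 'rV[R]_n.+1)
    (xi : 'rV[R]_n.+1 -> 'I_n.+1 -> 'rV[R]_n.+1)
    (M : R -> set 'rV[R]_n.+1) : Prop :=
  material_surface r U a b F M /\
  forall x, M b x -> tangent_orthogonal (M b) x (xi x ord_max).

Definition forward_stretch_surface (r : option nat) (U : set 'rV[R]_n.+1)
    (a b : R) (F : R -> R -> 'rV[R]_n.+1 -> 'rV[R]_n.+1)
    (xi : 'rV[R]_n.+1 -> 'I_n.+1 -> 'rV[R]_n.+1)
    (M : R -> set 'rV[R]_n.+1) : Prop :=
  material_surface r U a b F M /\
  forall x, M a x -> tangent_orthogonal (M a) x (xi x ord0).

Definition backward_stretch_surface (r : option nat) (U : set 'rV[R]_n.+1)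
    (a b : R) (F : R -> R -> 'rV[R]_n.+1 -> 'rV[R]_n.+1)
    (xi : 'rV[R]_n.+1 -> 'I_n.+1 -> 'rV[R]_n.+1)
    (M : R -> set 'rV[R]_n.+1) : Prop :=
  material_surface r U a b F M /\
  forall x, M b x -> tangent_orthogonal (M b) x (xi x ord0).

End Euclidean.

(* Main.v *)
Require Import Defs.
From HB Require Import structures.
From mathcomp Require Import all_boot all_order all_algebra.
From mathcomp Require Import all_classical all_reals all_analysis.
From mathcomp Require Import ring lra.
Import Order.TTheory GRing.Theory Num.Theory.
Import numFieldNormedType.Exports.
Local Open Scope classical_set_scope.
Local Open Scope ring_scope.

(** Let J be the Jacobian of the flow map from t0 to t1 at x, acting on row
vectors, and K = J^-1 the Jacobian of the reverse map.  Tangent vectors are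
carried by J, so normals are carried by K^T, and a surface with unit normal m
at x has normal repulsion 1 / |m K^T| there ([normal_repulsionE]).

Any unit vector m is the normal at x of some material surface: flow a piece
of hyperplane out of time a ([hyperplane_material]).  Comparing a most
repelling surface only with such tilted surfaces through the same point, its
unit normal n0 must be a strict local minimizer of |m K^T| on the unit sphere.
If w is a vector where the Rayleigh quotient of K^T K is globally smallest,
rotating n0 towards w (or - w) does not increase |m K^T|; by strictness the
rotation cannot move n0, so n0 is collinear with w and the tangent space is
orthogonal to w ([strict_min_collinear], [most_repelling_normal]).

Two vectors w qualify.  The top eigenvector of J J^T, the strain tensor at
time t0, is one because K^T K is the inverse of J J^T; this is the strain
property.  If xi_1 is a bottom eigenvector of K K^T, the strain tensor of the
reverse map at time t1, then xi_1 J^T is another one, and its transport to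
time t1 as a normal is xi_1 J^T K^T = xi_1; this is the stretch property.
Each vector is treated directly, so that multiple eigenvalues need no separate
discussion.  Taking (t0, t1) = (a, b) gives the repelling case, and (b, a) the
attracting one. *)

Set Implicit Arguments.
Unset Strict Implicit.

(** * The inner product and its normalization *)

Section DotProduct.
Context {R : realType} {n : nat}.
Implicit Types (v w m : 'rV[R]_n.+1) (A : 'M[R]_n.+1) (c : R).

Lemma dotE v w : dot v w = (v *m w^T) 0 0.
Proof. by rewrite mxE; apply: eq_bigr => i _; rewrite mxE. Qed.

Lemma dotC v w : dot v w = dot w v.
Proof. by apply: eq_bigr => i _; rewrite mulrC. Qed.

Lemma dotDl v1 v2 w : dot (v1 + v2) w = dot v1 w + dot v2 w.
Proof. by rewrite !dotE mulmxDl mxE. Qed.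

Lemma dotZl c v w : dot (c *: v) w = c * dot v w.
Proof. by rewrite !dotE -scalemxAl mxE. Qed.

Lemma dotDr v w1 w2 : dot v (w1 + w2) = dot v w1 + dot v w2.
Proof. by rewrite !(dotC v) dotDl. Qed.

Lemma dotZr c v w : dot v (c *: w) = c * dot v w.
Proof. by rewrite !(dotC v) dotZl. Qed.

Lemma dot0r v : dot v 0 = 0.
Proof. by rewrite -(scale0r v) dotZr mul0r. Qed.

Lemma dot_mull v A w : dot (v *m A) w = dot v (w *m A^T).
Proof. by rewrite !dotE trmx_mul trmxK mulmxA. Qed.

Lemma dot_mulr v w A : dot v (w *m A) = dot (v *m A^T) w.
Proof. by rewrite dot_mull trmxK. Qed.

Lemma dot_ge0 v : 0 <= dot v v.
Proof. by apply: sumr_ge0 => i _; rewrite -expr2 sqr_ge0. Qed.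

Lemma dot_eq0 v : (dot v v == 0) = (v == 0).
Proof.
apply/eqP/eqP => [h|->]; last exact: dot0r.
apply/rowP => i; rewrite mxE; apply/eqP.
have /psumr_eq0P/(_ h)/(_ i isT)/eqP : forall i : 'I_n.+1, true -> 0 <= v 0 i * v 0 i.
  by move=> j _; rewrite -expr2 sqr_ge0.
by rewrite mulf_eq0 orbb.
Qed.

Lemma dot_gt0 v : v != 0 -> 0 < dot v v.
Proof. by move=> v0; rewrite lt_neqAle dot_ge0 andbT eq_sym dot_eq0. Qed.

Lemma cauchy_schwarz v w : dot v w ^+ 2 <= dot v v * dot w w.
Proof.
have [->|w0] := eqVneq w 0; first by rewrite !dot0r expr0n mulr0.
have := dot_ge0 (dot w w *: v + (- dot v w) *: w).
rewrite [X in 0 <= X](_ : _ = dot w w * (dot v v * dot w w - dot v w ^+ 2));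
  last by rewrite !(dotDl, dotDr, dotZl, dotZr) (dotC w v); ring.
by rewrite pmulr_rge0 ?dot_gt0// subr_ge0.
Qed.

Definition normalize v : 'rV[R]_n.+1 := (Num.sqrt (dot v v))^-1 *: v.

Lemma sqrt_dot_gt0 v : v != 0 -> 0 < Num.sqrt (dot v v).
Proof. by move=> v0; rewrite sqrtr_gt0 dot_gt0. Qed.

Lemma dot_normalize v : v != 0 -> dot (normalize v) (normalize v) = 1.
Proof.
move=> v0; rewrite dotZl dotZr mulrA -expr2 exprVn sqr_sqrtr ?dot_ge0//.
by rewrite mulVf// dot_eq0.
Qed.

(** Supplies the small rotations of v towards u with which minimality is
tested. *)
Lemma near_normalize (v u : 'rV[R]_n.+1) (e : R) : dot v v = 1 -> 0 < e ->
  exists2 t : R, 0 < t & `|normalize (v + t *: u) - v| < e.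
Proof.
move=> v1 e0.
have vt : v + t *: u @[t --> (0 : R)] --> v.
  rewrite -[X in _ --> X]addr0 -[X in _ + X](scale0r u).
  by apply: cvgD; [exact: cvg_cst | apply: cvgZr_tmp; exact: cvg_id].
have dt : dot (v + t *: u) (v + t *: u) @[t --> (0 : R)] --> (1 : R).
  have -> : (fun t : R => dot (v + t *: u) (v + t *: u)) =
      (fun t : R => 1 + t * (2 * dot v u + t * dot u u)).
    apply/funext => t; rewrite !(dotDl, dotDr, dotZl, dotZr) v1 (dotC u v).
    by ring.
  rewrite -[X in _ --> X]addr0 -[X in _ + X](mul0r (2 * dot v u + 0 * dot u u)).
  apply: cvgD; first exact: cvg_cst.
  apply: cvgM; first exact: cvg_id.
  apply: cvgD; first exact: cvg_cst.
  by apply: cvgM; [exact: cvg_id | exact: cvg_cst].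
have st : Num.sqrt (dot (v + t *: u) (v + t *: u)) @[t --> (0 : R)]
    --> (1 : R).
  rewrite -[X in _ --> X]sqrtr1.
  exact: (cvg_comp _ _ dt (@sqrt_continuous R 1)).
have : normalize (v + t *: u) @[t --> (0 : R)] --> v.
  rewrite -[X in _ --> X]scale1r; apply: cvgZ vt.
  by rewrite -[X in _ --> X]invr1; apply: cvgV st; exact: oner_neq0.
move=> /cvgrPdist_lt/(_ e e0)/nbhs_ballP[d /= d0 hd].
exists (d / 2); first by rewrite divr_gt0.
rewrite distrC; apply: hd; rewrite /ball /= sub0r normrN gtr0_norm ?divr_gt0//.
by rewrite ltr_pdivrMr// mulr_natr mulr2n ltrDl.
Qed.

(** Write q(m) = |m P|^2 and D = |n0 + t u|^2 - 1.  As u is an eigenvector of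
the form q, q(n0 + t u) = q(n0) + mu D, so the normalized perturbation has
value (q(n0) + mu D) / (1 + D) <= q(n0) as soon as D >= 0, because
mu <= q(n0); strict minimality then forces it to equal n0.  The conclusion is phrased by orthogonality to
avoid handling the sign and scale of u. *)
Lemma strict_min_collinear (P : 'M[R]_n.+1) (mu e : R) n0 u : 0 < e ->
  dot n0 n0 = 1 ->
  (forall m, dot m m = 1 -> `|m - n0| < e -> m != n0 ->
    dot (n0 *m P) (n0 *m P) < dot (m *m P) (m *m P)) ->
  u *m P *m P^T = mu *: u ->
  mu <= dot (n0 *m P) (n0 *m P) ->
  forall v, dot v n0 = 0 -> dot v u = 0.
Proof.
(* With dot n0 u >= 0 the increment D below is nonnegative; else use - u. *)
move=> e0 n01 nmin; wlog : u / 0 <= dot n0 u => [wl|c0] uP mun v vn.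
  have [c0|c0] := leP 0 (dot n0 u); first exact: (wl u).
  apply/eqP; rewrite -oppr_eq0 -mulN1r -dotZr scaleN1r; apply/eqP.
  apply: wl => //; last by rewrite !mulNmx uP scalerN.
  by rewrite -scaleN1r dotZr mulN1r oppr_ge0 ltW.
have [t t0 te] := near_normalize u n01 e0.
set w := n0 + t *: u in te.
set D := 2 * t * dot n0 u + t ^+ 2 * dot u u.
have D0 : 0 <= D.
  by rewrite addr_ge0 ?mulr_ge0 ?dot_ge0 ?sqr_ge0 ?(ltW t0) ?ler0n.
have w2 : dot w w = 1 + D.
  by rewrite !(dotDl, dotDr, dotZl, dotZr) n01 (dotC u) /D; ring.
have D1 : 0 < 1 + D by rewrite ltr_pwDl.
have w0 : w != 0 by rewrite -dot_eq0 w2 gt_eqF.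
have uPdot x : dot (x *m P) (u *m P) = mu * dot x u.
  by rewrite dot_mull uP dotZr.
have wP : dot (w *m P) (w *m P) = dot (n0 *m P) (n0 *m P) + mu * D.
  rewrite mulmxDl -scalemxAl !(dotDl, dotDr, dotZl, dotZr).
  by rewrite (dotC (u *m P)) !uPdot /D; ring.
have [wn0|wn0] := eqVneq (normalize w) n0.
  have : dot v w = 0.
    have := congr1 (dot v) wn0; rewrite vn dotZr => /eqP.
    by rewrite mulf_eq0 invr_eq0 gt_eqF ?sqrt_dot_gt0//= => /eqP.
  rewrite dotDr vn add0r dotZr => /eqP.
  by rewrite mulf_eq0 gt_eqF//= => /eqP.
have := nmin _ (dot_normalize w0) te wn0.
rewrite -scalemxAl dotZl dotZr mulrA -expr2 exprVn sqr_sqrtr ?dot_ge0// w2 wP.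
rewrite (ltr_pdivlMl _ _ D1) mulrDl mul1r ltrD2l (mulrC D) ltNge.
by rewrite ler_wpM2r.
Qed.

(** * Rayleigh bounds and the minimizing vectors *)

Section Eigenframe.
Context (C : 'M[R]_n.+1) (lam : 'I_n.+1 -> R) (xi : 'I_n.+1 -> 'rV[R]_n.+1).
Hypothesis hC : ordered_eigenframe C lam xi.

Lemma eigenframeP i : xi i *m C = lam i *: xi i.
Proof. by have [_ _ /(_ i)/eigenspaceP] := hC. Qed.

Lemma eigenframe_expand v : v = \sum_i dot v (xi i) *: xi i.
Proof.
have [_ orth _] := hC.
pose X : 'M[R]_n.+1 := \matrix_i xi i.
have XX : X^T *m X = 1%:M.
  apply/mulmx1C/matrixP => i j.
  rewrite mxE [RHS]mxE -orth; apply: eq_bigr => k _.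
  by rewrite !mxE.
rewrite -{1}(mulmx1 v) -XX mulmxA mulmx_sum_row; apply: eq_bigr => i _.
rewrite rowK mxE; congr (_ *: _); apply: eq_bigr => k _.
by rewrite !mxE.
Qed.

Lemma dot_eigenframe v : dot v v = \sum_i dot v (xi i) ^+ 2.
Proof.
rewrite {2}(eigenframe_expand v) dotE raddf_sum mulmx_sumr summxE.
by apply: eq_bigr => i _; rewrite -dotE dotZr expr2.
Qed.

Lemma dot_mul_eigenframe v :
  dot (v *m C) v = \sum_i lam i * dot v (xi i) ^+ 2.
Proof.
rewrite {1}(eigenframe_expand v) mulmx_suml dotE mulmx_suml summxE.
apply: eq_bigr => i _; rewrite -scalemxAl eigenframeP -dotE !dotZl (dotC (xi i)).
by ring.
Qed.

Lemma rayleigh_max v : dot (v *m C) v <= lam ord_max * dot v v.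
Proof.
rewrite dot_mul_eigenframe dot_eigenframe mulr_sumr; apply: ler_sum => i _.
have [mono _ _] := hC.
by rewrite ler_wpM2r ?sqr_ge0// mono// leq_ord.
Qed.

Lemma rayleigh_min v : lam ord0 * dot v v <= dot (v *m C) v.
Proof.
rewrite dot_mul_eigenframe dot_eigenframe mulr_sumr; apply: ler_sum => i _.
have [mono _ _] := hC.
by rewrite ler_wpM2r ?sqr_ge0// mono.
Qed.

Lemma eigenframe_unit i : dot (xi i) (xi i) = 1.
Proof. by have [_ -> _] := hC; rewrite eqxx. Qed.

End Eigenframe.

(** Cauchy-Schwarz applied to m K^T and m J, whose inner product is |m|^2:
an upper bound on the stretching by J bounds |m K^T| from below. *)
Lemma inverse_expansion (J K : 'M[R]_n.+1) (mu : R) : J *m K = 1%:M -> 0 <= mu ->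
  (forall m, mu * dot (m *m J) (m *m J) <= dot m m) ->
  forall m, mu * dot m m <= dot (m *m K^T) (m *m K^T).
Proof.
move=> JK mu0 hJ m.
have [->|m0] := eqVneq m 0; first by rewrite mul0mx dot0r mulr0.
have mm : dot (m *m K^T) (m *m J) = dot m m.
  by rewrite dot_mull trmxK -mulmxA JK mulmx1.
have cs := cauchy_schwarz (m *m K^T) (m *m J); rewrite mm in cs.
rewrite -(ler_pM2r (dot_gt0 m0)) -mulrA -expr2.
apply: le_trans (ler_wpM2l mu0 cs) _.
by rewrite mulrCA ler_wpM2l ?dot_ge0.
Qed.

(** From xi J J^T = lam xi one gets xi J = lam xi K^T, hence xi K^T K =
lam^-1 xi; the bound comes from |m J|^2 <= lam |m|^2. *)
Lemma top_eigenvector_minimizes (J K : 'M[R]_n.+1) lam xi : J *m K = 1%:M ->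
  ordered_eigenframe (J *m J^T) lam xi ->
  xi ord_max *m K^T *m K = (lam ord_max)^-1 *: xi ord_max /\
  forall m, (lam ord_max)^-1 * dot m m <= dot (m *m K^T) (m *m K^T).
Proof.
move=> JK hxi.
have JKt : J^T *m K^T = 1%:M by rewrite -trmx_mul (mulmx1C JK) trmx1.
have max_gt0 : 0 < lam ord_max.
  have xiJ : xi ord_max *m J != 0.
    apply/eqP => xiJ; have := eigenframe_unit hxi ord_max.
    rewrite -[xi _]mulmx1 -JK mulmxA xiJ mul0mx dot0r => /esym/eqP.
    by rewrite oner_eq0.
  have <- : dot (xi ord_max *m J) (xi ord_max *m J) = lam ord_max.
    by rewrite dot_mulr -mulmxA (eigenframeP hxi) dotZl (eigenframe_unit hxi) mulr1.
  exact: dot_gt0.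
split.
  have xiJ : xi ord_max *m J = lam ord_max *: (xi ord_max *m K^T).
    by rewrite scalemxAl -(eigenframeP hxi) -!mulmxA JKt mulmx1.
  rewrite -[xi _ *m K^T]scale1r -(mulVf (lt0r_neq0 max_gt0)) -scalerA -xiJ.
  by rewrite -scalemxAl -mulmxA JK mulmx1.
apply: (inverse_expansion JK) => [|m]; first by rewrite invr_ge0 ltW.
by rewrite ler_pdivrMl// dot_mulr -mulmxA (rayleigh_max hxi).
Qed.

(** J J^T and K K^T live at different ends of the trajectory, and J^T
intertwines K K^T with K^T K.  The bound lam |m J|^2 <= |m|^2 is the minimum
principle for K K^T evaluated at m J, since m J K = m. *)
Lemma bottom_eigenvector_minimizes (J K : 'M[R]_n.+1) lam xi :
  J *m K = 1%:M -> ordered_eigenframe (K *m K^T) lam xi ->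
  xi ord0 *m J^T *m K^T *m K = lam ord0 *: (xi ord0 *m J^T) /\
  forall m, lam ord0 * dot m m <= dot (m *m K^T) (m *m K^T).
Proof.
move=> JK hxi.
have JKt : J^T *m K^T = 1%:M by rewrite -trmx_mul (mulmx1C JK) trmx1.
split.
  rewrite scalemxAl -(eigenframeP hxi) -!mulmxA (mulmxA J^T) JKt mul1mx.
  by rewrite (mulmx1C JKt) mulmx1.
apply: (inverse_expansion JK) => [|m].
  have <- : dot (xi ord0 *m K) (xi ord0 *m K) = lam ord0.
    by rewrite dot_mulr -mulmxA (eigenframeP hxi) dotZl (eigenframe_unit hxi) mulr1.
  exact: dot_ge0.
have := rayleigh_min hxi (m *m J).
by rewrite mulmxA -dot_mulr -(mulmxA m) JK mulmx1.
Qed.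

End DotProduct.

(** * Affine maps, curves and Jacobians *)

Section Calculus.
Context {R : realType}.

Lemma differentiable_mulmxr m k (P : 'M[R]_(m, k)) (v : 'rV[R]_m) :
  differentiable (fun w : 'rV[R]_m => w *m P) v.
Proof.
rewrite (_ : (fun _ => _) =
    \sum_(i < m) (fun w : 'rV[R]_m => (w 0 i : R) *: row i P)).
  apply: differentiable_sum => i; apply: differentiableZl.
  exact: differentiable_coord.
by apply/funext => w; rewrite mulmx_sum_row fct_sumE.
Qed.

Lemma derive_mulmxr m k (P : 'M[R]_(m, k)) (c : 'rV[R]_k) (v w : 'rV[R]_m) :
  'D_v (fun w => w *m P + c) w = v *m P.
Proof.
apply: cvg_lim => //.
apply: cvg_near_cst; near=> h.
rewrite opprD addrACA subrr addr0 -mulmxBl addrK -scalemxAl scalerA mulVf ?scale1r//.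
by near: h; exact: nbhs_dnbhs_neq.
Unshelve. all: by end_near. Qed.

Lemma jacobian_mulmxr m k (P : 'M[R]_(m, k)) (v : 'rV[R]_m) :
  'J (fun w => w *m P) v = P.
Proof.
apply/row_matrixP => i; rewrite !rowE -deriveEjacobian; last first.
  exact: differentiable_mulmxr.
rewrite [X in 'D__ X _](_ : _ = (fun w => w *m P + 0)) ?derive_mulmxr//.
by apply/funext => w; rewrite addr0.
Qed.

Lemma class_on_cst (V W : normedModType R) r (A : set V) (c : W) :
  class_on r A (cst c).
Proof.
suff Ck k : Ck_on k A (cst c) by case: r => [k|].
elim: k c => [|k IH] c /=; first by move=> x _; exact: cst_continuous.
split=> [x _|v]; first exact: differentiable_cst.
rewrite (_ : (fun _ => _) = cst 0); first exact: IH.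
by apply/funext => x; rewrite derive_cst.
Qed.

Lemma class_on_affine m k r (A : set 'rV[R]_m) (P : 'M[R]_(m, k)) (c : 'rV[R]_k) :
  class_on r A (fun w => w *m P + c).
Proof.
have df w : differentiable (fun w => w *m P + c) w.
  apply: (@differentiableD _ _ _ (fun w => w *m P) (cst c)).
    exact: differentiable_mulmxr.
  exact: differentiable_cst.
suff Ck l : Ck_on l A (fun w => w *m P + c) by case: r => [l|].
case: l => [|l] /=; first by move=> w _; exact/differentiable_continuous.
split=> // v; rewrite (_ : (fun _ => _) = cst (v *m P)).
  exact: (class_on_cst (Some l)).
by apply/funext => w; rewrite derive_mulmxr.
Qed.

Lemma class_on_differentiable (V W : normedModType R) r (A : set V) (f : V -> W) x :
  r <> Some 0%N -> class_on r A f -> A x -> differentiable f x.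
Proof. by case: r => [[|k]|] // _ => [|/(_ 1%N)] [df _] /df. Qed.

Lemma is_derive_curve m k (f : 'rV[R]_m -> 'rV[R]_k) (g : R -> 'rV[R]_m) (s : R) v :
  is_derive s (1 : R) g v -> differentiable f (g s) ->
  is_derive s (1 : R) (f \o g) (v *m 'J f (g s)).
Proof.
move=> gv df; have dg : differentiable g s.
  by apply/derivable1_diffP; have [] := gv.
have dfg := differentiable_comp dg df.
apply: DeriveDef; first exact/derivable1_diffP.
rewrite deriveE// diff_comp//= -(deriveE _ dg).
by rewrite (derive_val (is_derive := gv)) -(deriveE _ df) deriveEjacobian.
Qed.

Lemma jacobian_inverse m (f g : 'rV[R]_m -> 'rV[R]_m) x :
  differentiable f x -> differentiable g (f x) ->
  (\forall z \near x, g (f z) = z) -> 'J f x *m 'J g (f x) = 1%:M.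
Proof.
move=> df dg gf; apply/row_matrixP => i; rewrite !rowE mulmx1 mulmxA.
set e := delta_mx _ _.
rewrite -deriveEjacobian// -deriveEjacobian//.
rewrite (deriveE _ df) (deriveE _ dg).
have /(congr1 (@^~ e)) /= <- := diff_comp df dg.
rewrite -deriveE; last exact: differentiable_comp.
by rewrite -[RHS](derive_id x e); exact: near_eq_derive.
Qed.

End Calculus.

(** * Tangent vectors and normals of hypersurfaces *)

Section Tangent.
Context {R : realType} {n : nat}.
Implicit Types (S : set 'rV[R]_n.+1) (x v p : 'rV[R]_n.+1).

Lemma tangent_push S S' (f : 'rV[R]_n.+1 -> 'rV[R]_n.+1) x v :
  differentiable f x -> (\forall z \near x, S z -> S' (f z)) ->
  tangent S x v -> tangent S' (f x) (v *m 'J f x).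
Proof.
move=> df SS' [g [g0 Sg gv]]; rewrite -g0 in df SS' *.
exists (f \o g); split=> //; last exact: is_derive_curve.
have cg : {for (0 : R), continuous g}.
  by apply/differentiable_continuous/derivable1_diffP; have [] := gv.
have := cg _ SS'; rewrite nbhs_simpl /= => near0.
by near=> s => /=; apply: (near near0 s) => //; exact: (near Sg s).
Unshelve. all: by end_near. Qed.

Lemma tangent_hyperplane S x0 p x v :
  (forall z, S z -> dot (z - x0) p = 0) -> tangent S x v -> dot v p = 0.
Proof.
move=> Sp [g [_ Sg gv]].
have := is_derive_curve gv (differentiable_mulmxr p^T (g 0)).
rewrite jacobian_mulmxr => d1.
have d2 : is_derive (0 : R) 1 ((fun w => w *m p^T) \o g) 0.
  apply: (@near_eq_is_derive _ _ _ (cst (x0 *m p^T))) (is_derive_cst _ _ _).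
  near=> s; apply/esym/eqP; rewrite /= -subr_eq0 -mulmxBl; apply/eqP/rowP => i.
  by rewrite ord1 -dotE Sp ?mxE//; exact: (near Sg s).
rewrite dotE -(derive_val (is_derive := d1)) (derive_val (is_derive := d2)).
by rewrite mxE.
Unshelve. all: by end_near. Qed.

(** The gradient of the coordinate that a slice chart annihilates on S; it does
not vanish because the chart has an invertible Jacobian. *)
Lemma hypersurface_normal r S x : r <> Some 0%N -> hypersurface r S -> S x ->
  exists2 p, p != 0 & tangent_orthogonal S x p.
Proof.
move=> r0 hS Sx.
have [V [W [phi [psi [[oV oW] Vx [cphi cpsi] [phiK psiK] Sphi]]]]] := hS x Sx.
have [Wx _] := phiK x Vx.
have dphi := class_on_differentiable r0 cphi Vx.
have dpsi := class_on_differentiable r0 cpsi Wx.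
have VV : \forall z \near x, V z by exact: open_nbhs_nbhs.
have JK : 'J phi x *m 'J psi (phi x) = 1%:M.
  apply: jacobian_inverse => //.
  by near=> z; apply: (phiK z _).2; exact: (near VV z).
pose e : 'rV[R]_n.+1 := delta_mx 0 0.
exists (e *m ('J phi x)^T).
  apply/eqP => /(congr1 (mulmx^~ ('J psi (phi x))^T)).
  rewrite mul0mx -mulmxA -trmx_mul (mulmx1C JK) trmx1 mulmx1 => /rowP/(_ 0)/eqP.
  by rewrite !mxE !eqxx oner_eq0.
move=> v Sv; rewrite dot_mulr trmxK.
have dote z : dot z e = z 0 0.
  rewrite /dot (bigD1 0)//= big1 => [|i i0]; first by rewrite mxE !eqxx mulr1 addr0.
  by rewrite mxE (negbTE i0) andbF mulr0.
apply: (@tangent_hyperplane [set z | z 0 0 = 0] 0 _ (phi x)).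
  by move=> z /= z0; rewrite subr0 dote.
apply: tangent_push Sv => //.
by near=> z => /Sphi; apply; exact: (near VV z).
Unshelve. all: by end_near. Qed.

(** The column p^T has rank one, so Gaussian elimination writes it as an
invertible matrix times the first basis column times a nonzero scalar. *)
Lemma hyperplane_coordinates p : p != 0 -> exists2 P : 'M[R]_n.+1, P \in unitmx &
  forall v, (v *m P) 0 0 = 0 <-> dot v p = 0.
Proof.
move=> p0; exists (col_ebase p^T); first exact: col_ebase_unit.
move=> v; have rk : \rank p^T = 1%N by rewrite mxrank_tr rank_rV p0.
have r0 : row_ebase p^T 0 0 != 0.
  have := row_ebase_unit p^T; rewrite unitmxE unitfE.
  by rewrite [X in \det X]mx11_scalar det_scalar1.
have -> : dot v p = (v *m col_ebase p^T) 0 0 * row_ebase p^T 0 0.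
  rewrite dotE -[in LHS](mulmx_ebase p^T) rk !mulmxA mxE big_ord1.
  congr (_ * _); rewrite mxE big_ord_recl big1 => [|i _].
    by rewrite [X in _ * X]mxE /= mulr1 addr0.
  by rewrite [X in _ * X]mxE /= mulr0.
split=> [->|/eqP]; first by rewrite mul0r.
by rewrite mulf_eq0 (negbTE r0) orbF => /eqP.
Qed.

Lemma hypersurface_hyperplane r (U : set 'rV[R]_n.+1) x p : open U -> p != 0 ->
  hypersurface r (U `&` [set z | dot (z - x) p = 0]).
Proof.
move=> oU /hyperplane_coordinates[P Pu Pp] y [Uy _].
have cont (A : 'M[R]_n.+1) c : continuous (fun w : 'rV[R]_n.+1 => w *m A + c).
  move=> w; apply: (class_on_affine (Some 0%N) setT) => //.
exists U, [set z | U (z *m invmx P + x)],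
  (fun z => z *m P + - (x *m P)), (fun z => z *m invmx P + x).
have PK z : (z *m P + - (x *m P)) *m invmx P + x = z.
  by rewrite -mulmxBl mulmxK// subrK.
split => //.
- by split=> //; apply: open_comp => // z _; exact: cont.
- by split; exact: class_on_affine.
- split=> [z Uz|z Uz]; first by rewrite /= PK.
  by split=> //; rewrite mulmxDl mulmxKV// addrK.
- by move=> z Uz; rewrite -mulmxBl Pp; split=> [[]|].
Qed.

End Tangent.

(** * Material surfaces and their normals under the flow *)

Section Flow.
Context {R : realType} {n : nat} {r : option nat} {U : set 'rV[R]_n.+1}
  {a b : R} {u : 'rV[R]_n.+1 -> R -> 'rV[R]_n.+1}
  {F : R -> R -> 'rV[R]_n.+1 -> 'rV[R]_n.+1}.
Hypotheses (r0 : r <> Some 0%N) (oU : open U) (ab : a < b)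
  (hF : smooth_flow r U a b u F).
Implicit Types (M N : R -> set 'rV[R]_n.+1) (t : R) (x p m v : 'rV[R]_n.+1).

Let aI : a \in `[a, b]. Proof. by rewrite in_itv/= lexx ltW. Qed.

Lemma flow_stays t0 t1 x :
  t0 \in `[a, b] -> t1 \in `[a, b] -> U x -> U (F t0 t1 x).
Proof. by move=> I0 I1 Ux; have [] := flow_trajectory hF I0 Ux I1. Qed.

Lemma flow_comp t0 t1 t2 x : t0 \in `[a, b] -> t1 \in `[a, b] ->
  t2 \in `[a, b] -> U x -> F t1 t2 (F t0 t1 x) = F t0 t2 x.
Proof.
move=> I0 I1 I2 Ux; apply/esym.
exact: (flow_unique hF I1 (flow_trajectory hF I0 Ux) I2).
Qed.

Lemma flowK t0 t1 x : t0 \in `[a, b] -> t1 \in `[a, b] -> U x ->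
  F t1 t0 (F t0 t1 x) = x.
Proof. by move=> I0 I1 Ux; rewrite flow_comp// (flow_initial hF). Qed.

Lemma flow_differentiable t0 t1 x : t0 \in `[a, b] -> t1 \in `[a, b] -> U x ->
  differentiable (F t0 t1) x.
Proof.
by move=> I0 I1; exact: class_on_differentiable r0 (flow_class hF I0 I1).
Qed.

Lemma flow_jacobianK t0 t1 x : t0 \in `[a, b] -> t1 \in `[a, b] -> U x ->
  'J (F t0 t1) x *m 'J (F t1 t0) (F t0 t1 x) = 1%:M.
Proof.
move=> I0 I1 Ux; apply: jacobian_inverse.
- exact: flow_differentiable.
- by apply: flow_differentiable => //; exact: flow_stays.
- have UU : \forall z \near x, U z by exact: open_nbhs_nbhs.
  by near=> z; apply: flowK => //; exact: (near UU z).
Unshelve. all: by end_near. Qed.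

Lemma jacobian_covector_neq0 t0 t1 x p : t0 \in `[a, b] -> t1 \in `[a, b] ->
  U x -> p != 0 -> p *m ('J (F t1 t0) (F t0 t1 x))^T != 0.
Proof.
move=> I0 I1 Ux; apply: contra_neq => /(congr1 (mulmx^~ ('J (F t0 t1) x)^T)).
by rewrite mul0mx -mulmxA -trmx_mul flow_jacobianK// trmx1 mulmx1.
Qed.

Section Material.
Context {M : R -> set 'rV[R]_n.+1} (hM : material_surface r U a b F M).

Lemma material_transport t0 t1 x : t0 \in `[a, b] -> t1 \in `[a, b] ->
  M t0 x -> U x /\ M t1 (F t0 t1 x).
Proof.
have [MU _ Mt] := hM; move=> I0 I1.
rewrite (Mt _ I0) (Mt _ I1) => -[z Mz <-].
by split; [exact/flow_stays/MU | exists z => //; rewrite flow_comp//; exact: MU].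
Qed.

(** Normals move by the inverse transpose of the Jacobian.  Tangent vectors at
time t1 are pulled back by the reverse flow map. *)
Lemma normal_transport t0 t1 x p : t0 \in `[a, b] -> t1 \in `[a, b] ->
  M t0 x -> tangent_orthogonal (M t0) x p ->
  tangent_orthogonal (M t1) (F t0 t1 x) (p *m ('J (F t1 t0) (F t0 t1 x))^T).
Proof.
move=> I0 I1 Mx xp v Mv; have [Ux My] := material_transport I0 I1 Mx.
have [Uy _] := material_transport I1 I0 My.
rewrite dot_mulr trmxK; apply: xp; rewrite -{1}(flowK I0 I1 Ux).
apply: tangent_push Mv; first exact: flow_differentiable.
by apply: filterE => z; case/(material_transport I1 I0).
Qed.

(** Only the surface at time a is assumed to be a hypersurface, so a normal is
found there and transported. *)
Lemma material_normal t x : t \in `[a, b] -> M t x ->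
  exists2 p, p != 0 & tangent_orthogonal (M t) x p.
Proof.
move=> It Mx; have [Ux Mz] := material_transport It aI Mx.
have [Uz _] := material_transport aI It Mz.
have [_ hMa _] := hM; have [p p0 zp] := hypersurface_normal r0 hMa Mz.
have := normal_transport aI It Mz zp; rewrite (flowK It aI Ux).
move=> xp; eexists; last exact: xp.
have := jacobian_covector_neq0 aI It Uz p0.
by rewrite (flowK It aI Ux).
Qed.

End Material.

(** The hyperplane is placed at time a, where a material surface must be shown
to be a hypersurface, with the normal p that the flow carries to m; this way
regularity of images under the flow never has to be established. *)
Lemma hyperplane_material t x m : t \in `[a, b] -> U x -> m != 0 ->
  exists N, [/\ material_surface r U a b F N, N t x &
    tangent_orthogonal (N t) x m].
Proof.
move=> It Ux m0; pose z := F t a x.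
have Uz : U z by exact: flow_stays.
have zx : F a t z = x by exact: flowK.
pose p := m *m ('J (F a t) z)^T.
have pm : p *m ('J (F t a) x)^T = m.
  by rewrite -mulmxA -trmx_mul flow_jacobianK// trmx1 mulmx1.
have p0 : p != 0 by apply: contra_neq m0 => p0; rewrite -pm p0 mul0mx.
pose S := U `&` [set y | dot (y - z) p = 0].
have Sz : S z by split=> //=; rewrite subrr dotC dot0r.
have S_a : F a a @` S = S.
  apply/seteqP; split=> [_ [y Sy <-]|y Sy].
    by rewrite (flow_initial hF)//; case: Sy.
  by exists y => //; rewrite (flow_initial hF)//; case: Sy.
have hN : material_surface r U a b F (fun s => F a s @` S).
  split; rewrite ?S_a//; first by move=> y [].
  exact: hypersurface_hyperplane.
exists (fun s => F a s @` S); split=> //; first by exists z.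
have Sp : tangent_orthogonal (F a a @` S) z p.
  rewrite S_a => v; apply: (@tangent_hyperplane _ _ _ z).
  by move=> y [].
have Naz : (F a a @` S) z by rewrite S_a.
by have := normal_transport hN aI It Naz Sp; rewrite zx pm.
Qed.

Lemma unit_normal_normalize (S : set 'rV[R]_n.+1) x p : p != 0 ->
  tangent_orthogonal S x p -> unit_normal S x (normalize p).
Proof.
move=> p0 xp; split; first exact: dot_normalize.
by move=> v /xp vp; rewrite dotZr vp mulr0.
Qed.

Lemma normal_repulsionE t0 t1 x m : t0 \in `[a, b] -> t1 \in `[a, b] -> U x ->
  dot m m = 1 -> let w := m *m ('J (F t1 t0) (F t0 t1 x))^T in
  normal_repulsion (F t0 t1) x m (normalize w) = (Num.sqrt (dot w w))^-1.
Proof.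
move=> I0 I1 Ux m1 w; rewrite /normal_repulsion /nabla trmxK dotZl dot_mulr.
rewrite -mulmxA -trmx_mul flow_jacobianK// trmx1 mulmx1 m1 mulr1.
by rewrite ger0_norm// invr_ge0 sqrtr_ge0.
Qed.

(** The competitors all pass through x itself, so only the tilt of the tangent
space varies. *)
Lemma most_repelling_normal M t0 t1 x mu w :
  t0 \in `[a, b] -> t1 \in `[a, b] -> material_surface r U a b F M ->
  pointwise_most_repelling r U a b F t0 t1 M -> M t0 x ->
  let K := 'J (F t1 t0) (F t0 t1 x) in
  w *m K^T *m K = mu *: w ->
  (forall m, mu * dot m m <= dot (m *m K^T) (m *m K^T)) ->
  tangent_orthogonal (M t0) x w.
Proof.
move=> I0 I1 hM most Mx K wK muK.
have [Ux _] := material_transport hM I0 I1 Mx.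
have [p p0 xp] := material_normal hM I0 Mx.
have unit_neq0 m : dot m m = 1 -> m != 0.
  by move=> m1; rewrite -dot_eq0 m1 oner_eq0.
have unit_pair N m : material_surface r U a b F N -> N t0 x -> dot m m = 1 ->
    tangent_orthogonal (N t0) x m ->
    unit_normal (N t1) (F t0 t1 x) (normalize (m *m K^T)).
  move=> hN Nx m1 xm; apply: unit_normal_normalize.
    by apply: jacobian_covector_neq0 => //; exact: unit_neq0.
  exact: normal_transport.
have [n01 xn0] := unit_normal_normalize p0 xp.
set n0 := normalize p in n01 xn0.
have [e e0 he] := most x n0 _ Mx (conj n01 xn0) (unit_pair _ _ hM Mx n01 xn0).
have nK m : dot m m = 1 -> 0 < dot (m *m K^T) (m *m K^T).
  move=> m1; apply: dot_gt0; apply: jacobian_covector_neq0 => //.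
  exact: unit_neq0.
have nmin m : dot m m = 1 -> `|m - n0| < e -> m != n0 ->
    dot (n0 *m K^T) (n0 *m K^T) < dot (m *m K^T) (m *m K^T).
  move=> m1 me mn.
  have [N [hN Nx xm]] := hyperplane_material I0 Ux (unit_neq0 _ m1).
  have := he N 0 m (normalize (m *m K^T)) hN; rewrite scale0r addr0.
  move=> /(_ Nx (conj m1 xm) (unit_pair _ _ hN Nx m1 xm)).
  rewrite normr0 xpair_eqE eqxx (negbTE mn) => /(_ e0 me isT).
  rewrite !normal_repulsionE// ltf_pV2 ?posrE ?sqrtr_gt0 ?nK//.
  by rewrite ltr_sqrt ?nK.
move=> v xv; apply: (@strict_min_collinear _ _ K^T mu e n0) => //.
- by rewrite trmxK.
- by have := muK n0; rewrite n01 mulr1.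
- exact: xn0.
Qed.

(** * Strain and stretch surfaces *)

Lemma most_repelling_strain M t0 t1 x lam xi :
  t0 \in `[a, b] -> t1 \in `[a, b] -> material_surface r U a b F M ->
  pointwise_most_repelling r U a b F t0 t1 M -> M t0 x ->
  ordered_eigenframe (cauchy_green (F t0 t1) x) lam xi ->
  tangent_orthogonal (M t0) x (xi ord_max).
Proof.
move=> I0 I1 hM most Mx; rewrite /cauchy_green /nabla trmxK => hxi.
have [Ux _] := material_transport hM I0 I1 Mx.
have [xiK muK] := top_eigenvector_minimizes (flow_jacobianK I0 I1 Ux) hxi.
exact: most_repelling_normal xiK muK.
Qed.

(** The minimizing direction is found at time t0 and then transported, as a
normal, to time t1. *)
Lemma most_repelling_stretch M t0 t1 y lam xi :
  t0 \in `[a, b] -> t1 \in `[a, b] -> material_surface r U a b F M ->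
  pointwise_most_repelling r U a b F t0 t1 M -> M t1 y ->
  ordered_eigenframe (cauchy_green (F t1 t0) y) lam xi ->
  tangent_orthogonal (M t1) y (xi ord0).
Proof.
move=> I0 I1 hM most My; rewrite /cauchy_green /nabla trmxK => hxi.
have [Uy Mx] := material_transport hM I1 I0 My.
have JK := mulmx1C (flow_jacobianK I1 I0 Uy).
have [wK muK] := bottom_eigenvector_minimizes JK hxi.
have yE : F t0 t1 (F t1 t0 y) = y by exact: flowK.
have := @most_repelling_normal _ _ _ _ _ _ I0 I1 hM most Mx.
rewrite yE => /(_ _ _ wK muK) /(normal_transport hM I0 I1 Mx).
by rewrite yE -mulmxA -trmx_mul (mulmx1C JK) trmx1 mulmx1.
Qed.

End Flow.

Unset Implicit Arguments.
Set Strict Implicit.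

Theorem corollary1 (R : realType) (n : nat) (r : option nat)
    (U : set 'rV[R]_n.+1) (a b : R)
    (u : 'rV[R]_n.+1 -> R -> 'rV[R]_n.+1)
    (F : R -> R -> 'rV[R]_n.+1 -> 'rV[R]_n.+1)
    (lamf lamb : 'rV[R]_n.+1 -> 'I_n.+1 -> R)
    (xif xib : 'rV[R]_n.+1 -> 'I_n.+1 -> 'rV[R]_n.+1)
    (hr : r <> Some 0%N) (hU : open U) (hab : a < b)
    (hF : smooth_flow r U a b u F)
    (hf : forall x, U x ->
      ordered_eigenframe (cauchy_green (F a b) x) (lamf x) (xif x))
    (hb : forall x, U x ->
      ordered_eigenframe (cauchy_green (F b a) x) (lamb x) (xib x)) :
  (forall Rep : R -> set 'rV[R]_n.+1,
     repelling_LCS r U a b F Rep ->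
     forward_strain_surface r U a b F xif Rep /\
     backward_stretch_surface r U a b F xib Rep) /\
  (forall Att : R -> set 'rV[R]_n.+1,
     attracting_LCS r U a b F Att ->
     forward_stretch_surface r U a b F xif Att /\
     backward_strain_surface r U a b F xib Att).
Proof.
have aI : a \in `[a, b] by rewrite in_itv/= lexx ltW.
have bI : b \in `[a, b] by rewrite in_itv/= lexx ltW.
have inU M t x : material_surface r U a b F M -> t \in `[a, b] -> M t x -> U x.
  by move=> hM It Mx; case: (material_transport hab hF hM It It Mx).
split=> M [hM most]; (split; split=> // x Mx).
- apply: (most_repelling_strain hr hU hab hF aI bI hM most Mx).
  by apply: hf; exact: inU Mx.
- apply: (most_repelling_stretch hr hU hab hF aI bI hM most Mx).
  by apply: hb; exact: inU Mx.
- apply: (most_repelling_stretch hr hU hab hF bI aI hM most Mx).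
  by apply: hf; exact: inU Mx.
- apply: (most_repelling_strain hr hU hab hF bI aI hM most Mx).
  by apply: hb; exact: inU Mx.
Qed.
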